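(* Let $\Phi^h$ be the cumulative offer mechanism under the profile of aggregate choice rules $(\mathcal{C}^h_s)_{s\in S}$. Then $\Phi^h$ is stable with respect to $(\mathcal{C}^h_s)_{s\in S}$, strategy-proof for individuals, and eliminates justified envy.
   Context: Model. $I$ finite set of individuals, $S$ finite set of institutions. Reserve categories $R=\{SC,ST,OBC,EWS\}$, position types $V=\{o\}\cup R$ ($o$ = open). Institution $s$ has $q_s^r$ positions reserved for $r\in R$ and $q_s^o$ open positions. Individual $i$ has vertical membership $t(i)\in R\cup\{g\}$ ($g$ = general). Institution $s$ has a strict merit ranking $\succ_s$ of $I$. Contracts $X$: triples $(i,s,v)$ with $v=o$, or $v=t(i)$ if $t(i)\in R$; $\mathbf{i}(x),\mathbf{s}(x),\mathbf{t}(x)$ denote individual, institution, category; $Y_i,Y_s$ are the contracts of $Y$ involving $i$, resp. $s$; $\mathbf{i}(Y)=\{\mathbf{i}(x):x\in Y\}$. Each $i$ has a strict preference $P_i$ over pairs $(s,v)$ with $(i,s,v)\in X$ and the outside option $\emptyset$ ($R_i$ its weak version); $\mathcal{P}_i$ is the set of all such preferences. $H=\{h_1,\dots,h_L\}$ horizontal types, $\rho(i)\subseteq H$ types of $i$, $\rho^{-1}(h)=\{i:h\in\rho(i)\}$; hierarchical: if $\rho^{-1}(h)\cap\rho^{-1}(h')\neq\emptyset$ then one is a strict subset of the other ($h$ contains $h'$ if $\rho^{-1}(h')\subsetneq\rho^{-1}(h)$). For each $s$, $v$, reservations $\kappa^s_v\in\mathbb{Z}_+^L$; chosen individuals count against all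 their types. Hierarchical choice rule $C^h(A,\kappa,\rho)$ with capacity $q$ and ranking $\succ$: Step 1: let $H^1$ be the types containing no other type. If no individual in $A$ has a type, choose the $\min(q,|A|)$ highest-ranked and stop. Otherwise, for each $h_j\in H^1$ (fixed order, not exceeding remaining positions), choose all not-yet-chosen type-$h_j$ individuals of $A$ if at most $\kappa_j$, else the $\kappa_j$ highest-ranked; reduce remaining positions and the reservation of every type containing $h_j$ by the number chosen (floored at 0); remove $h_j$. Step $n\ge2$: stop if nothing remains; if no type remains, fill remaining positions by rank and stop; otherwise process remaining types containing no other remaining type as in Step 1. Output: all chosen individuals. Aggregate rule $\mathcal{C}^h_s$: process categories in order $o,SC,ST,OBC,EWS$; for category $v$, let $A_v$ be the individuals with a contract $(i,s,v)\in Y$ not chosen by an earlier category; apply $C^h(A_v,\kappa^s_v,\rho)$ with capacity $q^v_s$ and ranking $\succ_s$; select the contracts $(i,s,v)$ of the chosen; $\mathcal{C}^h_s(Y)$ is the union. Cumulative offer mechanism: at each step some individual for whom no institution currently holds a contract proposes her most-preferred acceptable contract not yet proposed; the institution $s$ receiving it holds $\mathcal{C}^h_s(A_s)$, where $A_s$ is the cumulative set of contracts ever proposed to $s$, and other institutions keep their held sets; the process ends when no individual can propose, and the outcome $\Phi^h(P)$ is the set of held contracts (it does not depend on the proposal order). A matching: each individual has at most one contract; feasible if category capacities are respected; $Y_i$ identified with $i$'s pair $(s,v)$ or $\emptyset$. Stable w.r.t. $(C_s)$: (1) $Y_iR_i\emptyset$ for all $i$; (2) $C_s(Y)=Y_s$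 for all $s$; (3) no nonempty $Z\subseteq X\setminus Y$ with $Z_s\subseteq C_s(Y\cup Z)$ for all $s\in\mathbf{s}(Z)$ and each $i\in\mathbf{i}(Z)$ having a single contract in $Z$ strictly preferred to $Y_i$. Eliminates justified envy: for every $j$ and $x\in Y\setminus Y_j$, $(\mathbf{s}(x),\mathbf{t}(x))P_jY_j$ implies $\mathbf{i}(x)\succ_{\mathbf{s}(x)}j$ or $\rho(j)\not\supseteq\rho(\mathbf{i}(x))$. A mechanism has a property if its outcome has it for every preference profile. Strategy-proof: for every profile $P$, individual $i$ and $\tilde P_i\in\mathcal{P}_i$, it is not the case that $\Phi^h(\tilde P_i,P_{-i})_i\,P_i\,\Phi^h(P)_i$. *)

(* Defs.v *)
From HB Require Import structures.
From mathcomp Require Import all_boot.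
Set Implicit Arguments. Unset Strict Implicit. Unset Printing Implicit Defensive.

Inductive cat := SC | ST | OBC | EWS.
Definition cat2o (c : cat) : 'I_4 :=
  match c with SC => inord 0 | ST => inord 1 | OBC => inord 2 | EWS => inord 3 end.
Definition o2cat (n : 'I_4) : cat :=
  match val n with 0 => SC | 1 => ST | 2 => OBC | _ => EWS end.
Lemma cat2oK : cancel cat2o o2cat. Proof. by case; rewrite /o2cat /= inordK. Qed.
HB.instance Definition _ := Countable.copy cat (can_type cat2oK).
HB.instance Definition _ := Finite.copy cat (can_type cat2oK).

Inductive vcat := Open | Res of cat.
Definition vcat2o (v : vcat) : option cat := match v with Open => None | Res c => Some c end.
Definition o2vcat (o : option cat) : vcat := match o with None => Open | Some c => Res c end.
Lemma vcat2oK : cancel vcat2o o2vcat. Proof. by case. Qed.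
HB.instance Definition _ := Countable.copy vcat (can_type vcat2oK).
HB.instance Definition _ := Finite.copy vcat (can_type vcat2oK).

Inductive memb := General | Mem of cat.
Definition memb2o (v : memb) : option cat := match v with General => None | Mem c => Some c end.
Definition o2memb (o : option cat) : memb := match o with None => General | Some c => Mem c end.
Lemma memb2oK : cancel memb2o o2memb. Proof. by case. Qed.
HB.instance Definition _ := Countable.copy memb (can_type memb2oK).
HB.instance Definition _ := Finite.copy memb (can_type memb2oK).

(* Horizontal types are H = {h_1,...,h_L} = 'I_L (fixed order = index order). *)
Record market (I S : finType) (L : nat) := Market {
  typ   : I -> memb;
  cap   : S -> vcat -> nat;
  rank  : S -> I -> nat;              (* merit: i ≻_s j  iff  rank s i < rank s j *)
  rho   : I -> {set 'I_L};
  kappa : S -> vcat -> 'I_L -> nat }.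

Definition contract (I S : finType) := (I * S * vcat)%type.
Definition ci {I S : finType} (x : contract I S) : I := x.1.1.
Definition cs {I S : finType} (x : contract I S) : S := x.1.2.
Definition ct {I S : finType} (x : contract I S) : vcat := x.2.

Definition valid_contract {I S : finType} (t : I -> memb) (x : contract I S) : bool :=
  match ct x with Open => true | Res c => t (ci x) == Mem c end.

Definition better {I : finType} (r : I -> nat) (i j : I) := r i < r j.

Definition pre {I : finType} {L : nat} (rho : I -> {set 'I_L}) (h : 'I_L) : {set I} :=
  [set i | h \in rho i].
Definition contains {I : finType} {L : nat} (rho : I -> {set 'I_L}) (h h' : 'I_L) : bool :=
  pre rho h' \proper pre rho h.
Definition hierarchical {I : finType} {L : nat} (rho : I -> {set 'I_L}) : Prop :=
  forall h h' : 'I_L, h != h' -> pre rho h :&: pre rho h' != set0 ->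
    contains rho h h' || contains rho h' h.

Definition top {I : finType} (r : I -> nat) (k : nat) (B : {set I}) : {set I} :=
  [set x in take k (sort (fun a b => r a <= r b) (enum B))].

Definition minimal_in {I : finType} {L : nat} (rho : I -> {set 'I_L}) (R : {set 'I_L}) :=
  [set h in R | [forall h' in R, ~~ contains rho h h']].

(* processing one type h: state = (chosen, remaining positions, reservations) *)
Definition process_type {I : finType} {L : nat} (r : I -> nat) (rho : I -> {set 'I_L})
    (A : {set I}) (st : {set I} * nat * ('I_L -> nat)) (h : 'I_L)
    : {set I} * nat * ('I_L -> nat) :=
  let: (C, p, k) := st in
  let B := [set i in A :\: C | h \in rho i] in
  let N := top r (minn (k h) p) B in
  let n := #|N| in
  (C :|: N, p - n, fun h' => if contains rho h' h then k h' - n else k h').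

Fixpoint hsteps {I : finType} {L : nat} (r : I -> nat) (rho : I -> {set 'I_L})
    (A : {set I}) (fuel : nat) (R : {set 'I_L}) (C : {set I}) (p : nat)
    (k : 'I_L -> nat) : {set I} :=
  match fuel with
  | 0 => C
  | fuel'.+1 =>
    if p == 0 then C
    else if R == set0 then C :|: top r p (A :\: C)
    else let M := minimal_in rho R in
         let: (C', p', k') := foldl (process_type r rho A) (C, p, k) (enum M) in
         hsteps r rho A fuel' (R :\: M) C' p' k'
  end.

Definition Chier {I : finType} {L : nat} (r : I -> nat) (rho : I -> {set 'I_L})
    (q : nat) (kappa : 'I_L -> nat) (A : {set I}) : {set I} :=
  if [forall i in A, rho i == set0] then top r q A
  else hsteps r rho A L.+2 [set: 'I_L] set0 q kappa.

Definition vorder : seq vcat := [:: Open; Res SC; Res ST; Res OBC; Res EWS].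

Definition agg_step {I S : finType} {L : nat} (m : market I S L) (s : S)
    (Y : {set contract I S}) (st : {set I} * {set contract I S}) (v : vcat) :=
  let: (Cd, out) := st in
  let Av := [set i | ((i, s, v) \in Y) && (i \notin Cd)] in
  let N := Chier (rank m s) (rho m) (cap m s v) (kappa m s v) Av in
  (Cd :|: N, out :|: [set x : contract I S | [&& ci x \in N, cs x == s & ct x == v]]).

Definition Cagg {I S : finType} {L : nat} (m : market I S L) (s : S)
    (Y : {set contract I S}) : {set contract I S} :=
  (foldl (agg_step m s Y) (set0, set0) vorder).2.

(* A strict preference of i over the pairs (s,v) with (i,s,v) ∈ X and the
   outside option ∅ (= None) is a duplicate-free list of exactly these
   options, most preferred first. *)
Definition pref (S : finType) := seq (option (S * vcat)).
Definition valid_opt {I S : finType} {L : nat} (m : market I S L) (i : I)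
    (o : option (S * vcat)) : bool :=
  match o with None => true | Some (s, v) => valid_contract (typ m) (i, s, v) end.
Definition wf_pref {I S : finType} {L : nat} (m : market I S L) (i : I) (p : pref S) :=
  uniq p && [forall o, (o \in p) == valid_opt m i o].
Definition wf_profile {I S : finType} {L : nat} (m : market I S L) (P : I -> pref S) :=
  forall i, wf_pref m i (P i).
Definition prefers {S : finType} (p : pref S) (a b : option (S * vcat)) := index a p < index b p.
Definition wprefers {S : finType} (p : pref S) (a b : option (S * vcat)) := index a p <= index b p.

Definition next_prop {I S : finType} (P : I -> pref S) (A : {set contract I S}) (i : I)
    : option (S * vcat) :=
  ohead [seq sv <- pmap id (take (index None (P i)) (P i)) | (i, sv.1, sv.2) \notin A].

Definition held {I S : finType} (Hd : S -> {set contract I S}) (i : I) : bool :=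
  [exists s, [exists x in Hd s, ci x == i]].

(* A = all contracts proposed so far; Hd s = set currently held by s.
   The proposing individual is the first eligible one in the enumeration of I
   (the outcome does not depend on the order). *)
Fixpoint co_run {I S : finType} {L : nat} (m : market I S L) (P : I -> pref S)
    (fuel : nat) (A : {set contract I S}) (Hd : S -> {set contract I S})
    : {set contract I S} :=
  match fuel with
  | 0 => \bigcup_s Hd s
  | n.+1 =>
    match [pick i | ~~ held Hd i & next_prop P A i != None] with
    | None => \bigcup_s Hd s
    | Some i =>
      match next_prop P A i with
      | None => \bigcup_s Hd s
      | Some (s, v) =>
        let A' := (i, s, v) |: A in
        (* 𝒞^h_s only looks at the contracts of A' involving s, i.e. at A'_s *)
        co_run m P n A' (fun s' => if s' == s then Cagg m s A' else Hd s')
      end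
    end
  end.

Definition Phi {I S : finType} {L : nat} (m : market I S L) (P : I -> pref S)
    : {set contract I S} :=
  co_run m P #|{: contract I S}|.+1 set0 (fun _ => set0).

Definition Yi {I S : finType} (Y : {set contract I S}) (i : I) := [set x in Y | ci x == i].
Definition Ys {I S : finType} (Y : {set contract I S}) (s : S) := [set x in Y | cs x == s].
Definition assign {I S : finType} (Y : {set contract I S}) (i : I) : option (S * vcat) :=
  omap (fun x : contract I S => (cs x, ct x)) [pick x in Yi Y i].

Definition is_matching {I S : finType} {L : nat} (m : market I S L) (Y : {set contract I S}) :=
  (forall x, x \in Y -> valid_contract (typ m) x) /\ (forall i, #|Yi Y i| <= 1).

Definition stable {I S : finType} {L : nat} (m : market I S L) (P : I -> pref S)
    (C : S -> {set contract I S} -> {set contract I S}) (Y : {set contract I S}) : Prop :=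
  is_matching m Y /\
  (forall i, wprefers (P i) (assign Y i) None) /\
  (forall s, C s Y = Ys Y s) /\
  ~ (exists Z : {set contract I S},
       [/\ Z != set0,
           (forall z, z \in Z -> valid_contract (typ m) z && (z \notin Y)),
           (forall s, s \in [set cs z | z in Z] -> Ys Z s \subset C s (Y :|: Z)) &
           (forall i, i \in [set ci z | z in Z] ->
              exists z, Yi Z i = [set z] /\ prefers (P i) (Some (cs z, ct z)) (assign Y i))]).

Definition eliminates_justified_envy {I S : finType} {L : nat} (m : market I S L)
    (P : I -> pref S) (Y : {set contract I S}) : Prop :=
  forall (j : I) (x : contract I S), x \in Y -> ci x != j ->
    prefers (P j) (Some (cs x, ct x)) (assign Y j) ->
    better (rank m (cs x)) (ci x) j \/ ~~ (rho m (ci x) \subset rho m j).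

Definition upd {I S : finType} (P : I -> pref S) (i : I) (p : pref S) : I -> pref S :=
  fun j => if j == i then p else P j.

Definition strategy_proof {I S : finType} {L : nat} (m : market I S L) : Prop :=
  forall P, wf_profile m P -> forall (i : I) (p' : pref S), wf_pref m i p' ->
    ~ prefers (P i) (assign (Phi m (upd P i p')) i) (assign (Phi m P) i).

(* Main.v *)
Require Import Defs.
From HB Require Import structures.
From mathcomp Require Import all_boot.
From mathcomp Require Import zify.
Set Implicit Arguments. Unset Strict Implicit. Unset Printing Implicit Defensive.

(* Treat every pair [(s, v)] as an office of its own that applies the
   hierarchical choice rule to all its applicants, chosen elsewhere or not. This
   rule is substitutable and size monotone: adding one applicant to the pool
   leaves two runs that differ, at any moment, by a single individual. Along the
   cumulative offer process nobody is chosen by two offices, and whenever that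
   is the case the aggregate rules select exactly what the offices select.
   Hence the mechanism is deferred acceptance between individuals and offices:
   its outcome is the stable assignment that everybody prefers to all others,
   and strategy-proofness follows from this optimality and the rural hospitals
   theorem. Envy-freeness is a property of the choice rule: an individual with
   better rank and more types is chosen no later. *)

(** * The [k] highest-ranked individuals of a pool *)

Section Top.
Context {I : finType} (r : I -> nat).
Hypothesis r_inj : injective r.
Implicit Types (k : nat) (B : {set I}).

Lemma index_count_sorted (s : seq I) i :
  sorted (fun a b => r a <= r b) s -> uniq s -> i \in s ->
  index i s = count (fun j => r j < r i) s.
Proof.
have tr : transitive (fun a b => r a <= r b) by move=> ? ? ?; apply: leq_trans.
elim: s => [//|a s IHs] /= pas /andP[as_ us]; rewrite inE.
have [-> _|nia /= i_s] := eqVneq i a; rewrite ?eqxx.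
  rewrite ltnn add0n; apply/esym/eqP; rewrite -leqn0 leqNgt -has_count.
  apply/hasPn => j js; rewrite -leqNgt.
  by move: pas; rewrite path_sortedE // => /andP[/allP/(_ j js)].
have ai : r a <= r i by move: pas; rewrite path_sortedE // => /andP[/allP/(_ i i_s)].
rewrite IHs //; last exact: path_sorted pas.
by rewrite ltn_neqAle ai (inj_eq r_inj) eq_sym nia.
Qed.

(** Without ties, the position of [i] in the sorted list is the number of better individuals. The
    counting form makes different pools and quotas comparable. *)
Lemma in_top k B i :
  (i \in top r k B) = (i \in B) && (#|[set j in B | r j < r i]| < k).
Proof.
rewrite inE; set s := sort _ _.
have ps : perm_eq s (enum B) by rewrite perm_sort.
have mem_s j : j \in s = (j \in B) by rewrite (perm_mem ps) mem_enum.
have [iB|niB] := boolP (i \in B); last first.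
  by apply/negP => /mem_take; rewrite mem_s (negPf niB).
rewrite in_take ?mem_s // index_count_sorted ?mem_s //; last first.
- by rewrite (perm_uniq ps) enum_uniq.
- by apply: sort_sorted => a b; apply: leq_total.
rewrite (permP ps) -size_filter -(card_uniqP (filter_uniq _ (enum_uniq _))).
by congr (_ < _); apply: eq_card => j; rewrite !inE mem_filter mem_enum andbC.
Qed.

Lemma card_top k B : #|top r k B| = minn k #|B|.
Proof.
rewrite cardsE (card_uniqP (take_uniq _ _)) ?sort_uniq ?enum_uniq //.
by rewrite size_take_min size_sort -cardE.
Qed.

Lemma top_sub k B : top r k B \subset B.
Proof. by apply/subsetP => i; rewrite inE => /mem_take; rewrite mem_sort mem_enum. Qed.

Lemma top0 B : top r 0 B = set0.
Proof. by apply/setP=> i; rewrite /top take0 !inE. Qed.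

Lemma top_all k B : #|B| <= k -> top r k B = B.
Proof. by move=> Bk; apply/eqP; rewrite eqEcard top_sub card_top (minn_idPr Bk) leqnn. Qed.

Lemma top_up k B i j : j \in B -> r j < r i -> i \in top r k B -> j \in top r k B.
Proof.
move=> jB ji; rewrite !in_top jB => /andP[_]; apply: leq_ltn_trans.
by apply/subset_leq_card/subsetP => l; rewrite !inE => /andP[-> /ltn_trans->].
Qed.

Lemma subset_rem1 (X Y : {set I}) :
  X \subset Y -> #|Y| = #|X|.+1 -> exists2 a, a \in Y & X = Y :\ a.
Proof.
move=> XY cY; have: #|Y :\: X| = 1 by rewrite cardsD (setIidPr XY) cY subSnn.
move/eqP/cards1P => [a Da]; exists a.
  by have: a \in Y :\: X by [rewrite Da set11]; rewrite inE => /andP[].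
by rewrite -Da setDDr setDv set0U (setIidPr XY).
Qed.

Lemma top_pred t B : t < #|B| ->
  exists2 a, a \in top r t.+1 B & top r t B = top r t.+1 B :\ a.
Proof.
move=> tB; apply: subset_rem1; last by rewrite !card_top; lia.
by apply/subsetP=> i; rewrite !in_top => /andP[-> /leqW].
Qed.

(** A newcomer only worsens the standing of the others, so the new selection lies in
    [x |: top r t B]; as [t <= #|B|], it is smaller by exactly one. *)
Lemma top_setU1 t B x : x \notin B -> t <= #|B| ->
  exists2 a, a \in x |: top r t B & top r t (x |: B) = (x |: top r t B) :\ a.
Proof.
move=> xB tB; apply: subset_rem1; last first.
  rewrite cardsU1 !card_top cardsU1 xB.
  by rewrite (contra (subsetP (top_sub t B) x)) //; lia.
apply/subsetP=> i; rewrite in_setU1 !in_top in_setU1.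
move=> /andP[/predU1P[->|iB] lt]; rewrite ?eqxx // iB orbC.
apply/orP; left; apply: leq_ltn_trans lt.
by apply/subset_leq_card/subsetP => l; rewrite !inE => /andP[-> ->]; rewrite orbT.
Qed.
End Top.

(** * The hierarchical choice rule as one fold over the types *)

Section Chier.
Context {I : finType} {L : nat} (r : I -> nat) (rho : I -> {set 'I_L}).
Hypothesis r_inj : injective r.
Notation state := ({set I} * nat * ('I_L -> nat))%type.
Implicit Types (A : {set I}) (st : state) (s : seq 'I_L) (R : {set 'I_L}).

Definition fill A st := st.1.1 :|: top r st.1.2 (A :\: st.1.1).

(** The order of treatment depends neither on the pool nor on earlier choices, so runs on different
    pools can be compared type by type. *)
Fixpoint type_order (fuel : nat) R : seq 'I_L :=
  if fuel is n.+1 then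
    if R == set0 then [::]
    else enum (minimal_in rho R) ++ type_order n (R :\: minimal_in rho R)
  else [::].

Definition precedes : rel 'I_L := [rel h h' | (h != h') && ~~ contains rho h h'].

Lemma minimal_in_sub R : minimal_in rho R \subset R.
Proof. by apply/subsetP => h; rewrite inE => /andP[]. Qed.

Lemma minimal_in_neq0 R : R != set0 -> minimal_in rho R != set0.
Proof.
move=> /set0Pn[h0 h0R]; apply/set0Pn.
case: (arg_minnP (fun h => #|pre rho h|) h0R) => h hR hmin; exists h.
rewrite inE; apply/andP; split=> //; apply/forall_inP => h' h'R; apply/negP => /proper_card.
by rewrite ltnNge hmin.
Qed.

Lemma mem_type_order fuel R h : h \in type_order fuel R -> h \in R.
Proof.
elim: fuel R => //= n IHn R; case: eqP => // _; rewrite mem_cat mem_enum.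
by case/orP => [/(subsetP (minimal_in_sub R))|/IHn /setDP[]].
Qed.

Lemma pairwise_all {T : eqType} (e : rel T) (s : seq T) :
  {in s &, forall x y, e x y} -> pairwise e s.
Proof.
elim: s => //= x s IHs es; rewrite IHs => [|y z ys zs]; last first.
  by rewrite es // inE ?ys ?zs orbT.
by rewrite andbT; apply/allP => y ys; rewrite es // inE ?eqxx ?ys ?orbT.
Qed.

Lemma type_order_pairwise fuel R : pairwise precedes (type_order fuel R).
Proof.
elim: fuel R => //= n IHn R; case: eqP => // _.
have minP h h' : h \in minimal_in rho R -> h' \in R -> ~~ contains rho h h'.
  by rewrite inE => /andP[_ /forall_inP]; apply.
rewrite pairwise_cat IHn andbT; apply/andP; split.
  apply/allrelP => h h'; rewrite mem_enum => hM /mem_type_order /setDP[h'R h'M].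
  by rewrite /precedes /= minP // andbT; apply: contraNneq h'M => <-.
rewrite /precedes pairwise_relI -uniq_pairwise enum_uniq /=.
apply: pairwise_all => h h'; rewrite !mem_enum => hM h'M /=.
by rewrite minP ?(subsetP (minimal_in_sub R)).
Qed.

Lemma foldl_process_full A C k s :
  (foldl (process_type r rho A) (C, 0, k) s).1 = (C, 0).
Proof. by elim: s k => //= h s IHs k; rewrite minn0 (top0 r) setU0 IHs. Qed.

(** The early stop is absorbed because processing a type with no position left chooses nobody. Each
    round removes a minimal type, which bounds the fuel. *)
Lemma hstepsE A fuel R C p k : #|R| < fuel ->
  hsteps r rho A fuel R C p k
  = fill A (foldl (process_type r rho A) (C, p, k) (type_order fuel R)).
Proof.
elim: fuel R C p k => //= n IHn R C p k Rn.
have [->|p0] := eqVneq p 0.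
  by rewrite /fill foldl_process_full /= (top0 r) setU0.
have [_|R0] := eqVneq R set0; first by [].
rewrite foldl_cat; case: (foldl _ _ (enum _)) => [[C' p'] k']; rewrite IHn //.
rewrite -ltnS (leq_trans _ Rn) // ltnS; apply: proper_card.
have [h hM] := set0Pn _ (minimal_in_neq0 R0); apply/properP; split; first exact: subsetDl.
by exists h; [apply: subsetP hM; apply: minimal_in_sub | rewrite inE hM].
Qed.

(** If nobody has a type, every type selects from an empty pool and all [q] positions are left to
    [fill]. *)
Lemma ChierE q k A :
  Chier r rho q k A
  = fill A (foldl (process_type r rho A) (set0, q, k) (type_order L.+2 setT)).
Proof.
rewrite /Chier; case: ifP => [/forall_inP A0|_]; last first.
  by rewrite hstepsE // cardsT card_ord.
suff: forall s k0, (foldl (process_type r rho A) (set0, q, k0) s).1 = (set0, q).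
  by rewrite /fill => ->; rewrite /= setD0 set0U.
elim=> //= h s IHs k0; set N := top _ _ _.
suff -> : N = set0 by rewrite setU0 cards0 subn0 IHs.
apply/eqP; rewrite -subset0 (subset_trans (top_sub r _ _)) //.
by apply/subsetP => i; rewrite !inE => /andP[/A0/eqP->]; rewrite inE.
Qed.

Lemma process_sub A st h : st.1.1 \subset A ->
  (process_type r rho A st h).1.1 \subset A.
Proof.
case: st => [[C p] k] /= CA; rewrite subUset CA (subset_trans (top_sub r _ _)) //.
by apply/subsetP => i; rewrite !inE => /andP[/andP[]].
Qed.

Lemma foldl_process_sub A st s : st.1.1 \subset A ->
  (foldl (process_type r rho A) st s).1.1 \subset A.
Proof. by elim: s st => //= h s IHs st /process_sub/IHs. Qed.

Lemma Chier_sub q k A : Chier r rho q k A \subset A.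
Proof.
rewrite ChierE /fill subUset foldl_process_sub ?sub0set //=.
by rewrite (subset_trans (top_sub r _ _)) // subsetDl.
Qed.

(** The implication from [i] chosen to [j] chosen survives every step: while [j] waits, it is in
    each pool that contains [i] and stands above [i] there. *)
Lemma Chier_no_envy q k A i j :
  i \in Chier r rho q k A -> j \in A -> rho i \subset rho j -> r j < r i ->
  j \in Chier r rho q k A.
Proof.
move=> iC jA ij ji; rewrite ChierE in iC *.
set st := foldl _ _ _ in iC *.
have stP : i \in st.1.1 -> j \in st.1.1.
  rewrite {iC}/st; set st0 := (set0, q, k).
  have: i \in st0.1.1 -> j \in st0.1.1 by rewrite inE.
  elim: (type_order _ _) st0 => //= h s IHs [[C p] k0] /= Cij.
  apply: IHs; rewrite /= !(in_setU _ C) => /orP[/Cij->//|].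
  have [//|jC iN] := boolP (j \in C); apply: (top_up r_inj _ ji iN).
  have := subsetP (top_sub r _ _) _ iN; rewrite !inE jC jA /=.
  by case/andP => _ /(subsetP ij).
rewrite /fill !(in_setU _ st.1.1) in iC *.
have [//|jC] := boolP (j \in st.1.1); move: iC; rewrite (contraNF stP jC) /=.
by apply: top_up => //; rewrite inE jC.
Qed.

(** * Runs on two pools that differ by one applicant *)

Section Simulation.
Hypothesis hier : hierarchical rho.
Context (A : {set I}) (b : I).
Hypothesis bA : b \notin A.

(* Runs of the rule on [A] and on [b |: A]: either the second run has left out
   exactly one more individual [x], or it has chosen exactly one more, of type
   [h0], which uses up one position and one reservation of each type above [h0] *)
Variant coupled s st st' : Prop :=
| OneLeftOut x of x \in b |: st.1.1 & st'.1.1 = (b |: st.1.1) :\ x &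
    st'.1.2 = st.1.2 & st.1.2 = 0 \/ {in s, st'.2 =1 st.2}
| OneMoreChosen h0 of st'.1.1 = b |: st.1.1 & st.1.2 = st'.1.2.+1 &
    pre rho h0 != set0 & {in s, forall h, st'.2 h = st.2 h - contains rho h h0}.

Lemma left_out (C : {set I}) x : C \subset A -> x \in b |: C ->
  (b |: A) :\: ((b |: C) :\ x) = x |: (A :\: C) /\ x \notin A :\: C.
Proof.
move=> CA; rewrite in_setU1 => /predU1P xbC.
have xA : x \notin A :\: C.
  by rewrite inE negb_and negbK; case: xbC => [->|->//]; rewrite bA orbT.
split=> //; apply/setP => i; rewrite !inE.
have [->|ix] := eqVneq i x; last have [->|ib] := eqVneq i b => //=.
  by case: xbC => [->|xC]; rewrite ?eqxx // (subsetP CA) ?orbT.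
by rewrite (negPf bA) andbF.
Qed.

Lemma none_left_out (C : {set I}) : (b |: A) :\: (b |: C) = A :\: C.
Proof.
apply/setP => i; rewrite !inE; have [->|//] := eqVneq i b.
by rewrite (negPf bA) andbF.
Qed.
(** If the quota binds, the extra candidate [x] displaces at most one individual, who is then the
    one left out; if there is room, [x] is picked on top of [B] and the second run is one ahead. *)
Lemma pick_left_out (C B B' : {set I}) x t :
    C \subset A -> x \in b |: C -> x \notin B -> B \subset A :\: C ->
    B' = B \/ B' = x |: B ->
  let N := top r t B in let N' := top r t B' in
  (exists2 y, y \in b |: (C :|: N) &
     ((b |: C) :\ x) :|: N' = (b |: (C :|: N)) :\ y /\ #|N'| = #|N|) \/
  [/\ ((b |: C) :\ x) :|: N' = b |: (C :|: N), #|N'| = #|N|.+1 & B' = x |: B].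
Proof.
move=> CA xbC xB BAC BB' N N'; have NB : N \subset B by apply: top_sub.
have xN : x \notin N by apply: contra xB; apply: subsetP.
have bCNx : ((b |: C) :\ x) :|: N = (b |: (C :|: N)) :\ x.
  apply/setP => i; rewrite !(in_setU, in_setD, in_set1).
  by have [->|] := eqVneq i x; rewrite ?(negPf xN) //= orbA.
have xbCN : x \in b |: (C :|: N) by rewrite setUA inE xbC.
case: BB' => [B'B|B'xB]; first by left; exists x; rewrite // /N' B'B.
have [tB|Bt] := leqP t #|B|; last first.
  right; have -> : N = B by rewrite /N (top_all r) 1?ltnW.
  have -> : N' = x |: B by rewrite /N' (top_all r) B'xB // cardsU1 xB.
  split; rewrite ?cardsU1 ?xB //.
  by rewrite setUCA setUA setD1K // setUA.
have [a aN N'E] := top_setU1 r_inj xB tB; rewrite -/N in aN N'E.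
left; exists a.
  move: aN; rewrite !(in_setU, in_set1) => /predU1P[->|->]; last by rewrite !orbT.
  by move: xbC; rewrite in_setU1 orbA => ->.
split; last by rewrite !card_top // B'xB cardsU1 xB; lia.
have aDC : (a == x) || (a \notin b |: C).
  move: aN; rewrite in_setU1 => /predU1P[->|/(subsetP NB)/(subsetP BAC)]; rewrite ?eqxx //.
  rewrite !inE negb_or => /andP[-> aA]; rewrite andbT.
  by rewrite (contraNneq _ bA) ?orbT // => <-.
rewrite /N' B'xB N'E; apply/setP => i; rewrite !(in_setU, in_setD, in_set1).
have [->|ia] := eqVneq i a; last have [->|ix] := eqVneq i x => //=.
- by case/orP: aDC => [->//|]; rewrite in_setU1 => /negPf->; rewrite andbF.
- by move: xbC; rewrite in_setU1 orbA => ->.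
- by rewrite orbA.
Qed.

(** With one position less on the same pool, only the last pick is lost, and becomes the one left
    out. *)
Lemma pick_one_less (C B : {set I}) t :
    B \subset A :\: C -> 0 < t <= #|B| ->
  exists2 a, a \in b |: (C :|: top r t B) &
    (b |: C) :|: top r t.-1 B = (b |: (C :|: top r t B)) :\ a.
Proof.
case: t => // t BAC /= tB; have [a aN ->] := top_pred r_inj tB.
exists a; first by rewrite !in_setU aN !orbT.
have /(subsetP BAC) := subsetP (top_sub r _ _) _ aN.
rewrite inE => /andP[aC aA]; have ab : a != b by apply: contraNneq bA => <-.
apply/setP => i; rewrite !(in_setU, in_setD, in_set1).
have [->|_] := eqVneq i a; last by rewrite orbA.
by rewrite (negPf aC) (negPf ab).
Qed.

(** The two cases feed into each other. A left-out [x] of type [h] may be picked additionally, which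
    makes [h] the new [h0]; being one ahead may cost the second run one pick of type [h], which
    levels the counts again. *)
Lemma coupled_process s st st' h : st.1.1 \subset A -> all (precedes h) s ->
  coupled (h :: s) st st' ->
  coupled s (process_type r rho A st h) (process_type r rho (b |: A) st' h).
Proof.
case: st st' => [[C p] k] [[C' p'] k'] /= CA hs.
case=> [x xbC /= -> ->|h0 /= -> -> h0N0 k'E].
  move=> kE; have [AC xAC] := left_out CA xbC.
  set B := [set i in A :\: C | _]; set B' := [set i in _ | _].
  have BAC : B \subset A :\: C by apply/subsetP => i; rewrite inE => /andP[].
  have xB : x \notin B by apply: contra xAC; apply: subsetP.
  have BB' : B' = (if h \in rho x then x |: B else B).
    rewrite /B' AC; apply/setP => i; rewrite [LHS]inE in_setU1.
    rewrite (fun_if (fun X : {set I} => i \in X)).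
    rewrite in_setU1; have [->|_] := eqVneq i x.
      by rewrite (negPf xB); case: (h \in rho x).
    by rewrite if_same [RHS]inE.
  case: kE => [p0|kE].
    rewrite p0 !minn0 !(top0 r) !setU0 cards0 !sub0n.
    by apply: (@OneLeftOut _ _ _ x) => //; left.
  have -> : k' h = k h by apply: kE; rewrite mem_head.
  have {}BB' : B' = B \/ B' = x |: B /\ h \in rho x by rewrite BB'; case: ifP; auto.
  have := @pick_left_out C B B' x (minn (k h) p) CA xbC xB BAC.
  case=> [|[y ybCN [CNE cN]]|[CNE cN B'E]]; first by case: BB' => [|[]]; auto.
    rewrite CNE cN; apply: (@OneLeftOut _ _ _ y) => //; right=> h' h's /=.
    by rewrite kE // inE h's orbT.
  have hx : h \in rho x
    by case: BB' => [|[_ //]]; rewrite B'E => /setP/(_ x); rewrite setU11 (negPf xB).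
  apply: (@OneMoreChosen _ _ _ h) => //=.
  - rewrite cN; have := subset_leq_card (top_sub r (minn (k h) p) B').
    have := card_top r (minn (k h) p) B'; lia.
  - by apply/set0Pn; exists x; rewrite inE.
  - move=> h' h's; rewrite kE ?inE ?h's ?orbT // cN.
    by case: ifP => /= _; lia.
rewrite (none_left_out C).
set B := [set i in A :\: C | _].
have BAC : B \subset A :\: C by apply/subsetP => i; rewrite inE => /andP[].
have kE' h' : h' \in s -> k' h' = k h' - contains rho h' h0.
  by move=> h's; rewrite k'E // inE h's orbT.
have k'hE : k' h = k h - contains rho h h0 by rewrite k'E ?mem_head.
set t := minn (k h) p'.+1; set t' := minn (k' h) p'.
have tp : t <= p'.+1 by apply: geq_minr.
have cN := card_top r t B; have cN' := card_top r t' B.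
(* The quotas differ by at most one: the second run lacks one position and at most one reservation
   for [h]. *)
have [NE|[t'E tB]] : top r t' B = top r t B \/ t' = t.-1 /\ 0 < t <= #|B|.
- have [tB|tB] := boolP (0 < t <= #|B|); last first.
    left; have [Bt|Bt] := leqP t #|B|.
      by have [-> ->] : t = 0 /\ t' = 0 by lia.
    by rewrite !(top_all r) //; lia.
  have [|] : t' = t \/ t' = t.-1 by rewrite /t /t' k'hE; case: contains; lia.
    by move=> ->; left.
  by right.
- apply: (@OneMoreChosen _ _ _ h0) => //=; rewrite NE ?setUA //.
    by move: cN'; rewrite NE cN; have := geq_minr (k' h) p'; rewrite -/t'; lia.
  by move=> h' h's; rewrite kE' //; case: ifP => _; lia.
have [a aN CNE] := pick_one_less BAC tB; rewrite -t'E in CNE.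
apply: (@OneLeftOut _ _ _ a) => //=; first by lia.
(* If [h] does not contain [h0], the quota shrank only for want of a position; then [t] exhausts the
   positions of the first run, and both runs are full. *)
have [c0|c1] := boolP (contains rho h h0); last first.
  by left; move: t'E tB cN; rewrite /t /t' k'hE (negPf c1); lia.
right=> h' h's; rewrite kE' //.
(* If [h] and [h'] both contain [h0], they share its members, so the hierarchy makes them
   comparable; the processing order leaves only [h'] containing [h]. *)
suff -> : contains rho h' h0 = contains rho h' h by case: (contains rho h' h); lia.
have /andP[nhh' ncc] := allP hs h' h's.
apply/idP/idP => [c0'|c]; last exact: proper_trans c0 c.
have /(hier nhh') : pre rho h :&: pre rho h' != set0.
  have [x xh0] := set0Pn _ h0N0; apply/set0Pn; exists x.
  by rewrite inE (subsetP (proper_sub c0)) ?(subsetP (proper_sub c0')).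
by rewrite (negPf ncc).
Qed.

Lemma coupled_foldl s st st' : st.1.1 \subset A -> pairwise precedes s ->
  coupled s st st' ->
  coupled [::] (foldl (process_type r rho A) st s)
               (foldl (process_type r rho (b |: A)) st' s).
Proof.
elim: s st st' => //= h s IHs st st' CA /andP[hs ps] cst.
by apply: IHs; [apply: process_sub | | apply: coupled_process].
Qed.

(** The final filling is one more pick, from everybody still waiting, so the two picking lemmas
    apply again. The new choice is [b |: fill A st] with at most one individual removed. *)
Lemma coupled_fill st st' : st.1.1 \subset A -> coupled [::] st st' ->
  fill (b |: A) st' \subset b |: fill A st /\ #|fill A st| <= #|fill (b |: A) st'|.
Proof.
case: st st' => [[C p] k] [[C' p'] k'] /= CA.
have FA : fill A (C, p, k) \subset A.
  by rewrite /fill subUset CA (subset_trans (top_sub r _ _)) // subsetDl.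
have card_bF : #|b |: fill A (C, p, k)| = #|fill A (C, p, k)|.+1.
  by rewrite cardsU1 (contra (subsetP FA b)).
have rem1 (F : {set I}) y : y \in b |: fill A (C, p, k) ->
    F = (b |: fill A (C, p, k)) :\ y ->
  F \subset b |: fill A (C, p, k) /\ #|fill A (C, p, k)| <= #|F|.
  move=> yF ->; split; first exact: subsetDl.
  by have := cardsD1 y (b |: fill A (C, p, k)); rewrite yF card_bF => -[->].
have all1 (F : {set I}) : F = b |: fill A (C, p, k) ->
  F \subset b |: fill A (C, p, k) /\ #|fill A (C, p, k)| <= #|F|.
  by move=> ->; rewrite card_bF.
case=> [x xbC /= -> -> _|h0 /= -> pE _ _]; last subst p.
  have [AC xAC] := left_out CA xbC.
  have [|[y yF [FE _]]|[FE _ _]] :=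
      @pick_left_out C (A :\: C) (x |: (A :\: C)) x p CA xbC xAC (subxx _).
  - by right.
  - by apply: (rem1 _ y); rewrite // /fill /= AC.
  - by apply: all1; rewrite /fill /= AC.
have [tB|Bt] := leqP p'.+1 #|A :\: C|.
  have [//|a aF FE] := @pick_one_less C (A :\: C) p'.+1 (subxx _).
  by apply: (rem1 _ a); rewrite // /fill /= none_left_out.
apply: all1; rewrite /fill /= none_left_out !(top_all r) ?setUA //.
exact: ltnW.
Qed.

Lemma Chier_setU1 q k :
  Chier r rho q k (b |: A) \subset b |: Chier r rho q k A /\
  #|Chier r rho q k A| <= #|Chier r rho q k (b |: A)|.
Proof.
rewrite !ChierE; apply: coupled_fill.
  by rewrite foldl_process_sub ?sub0set.
apply: coupled_foldl; rewrite ?sub0set ?type_order_pairwise //.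
(* Initially nobody is chosen and [b] itself is left out. *)
apply: (@OneLeftOut _ _ _ b) => //=; first by rewrite setU11.
  by rewrite setU0 setDv.
by right.
Qed.
End Simulation.

(** * Substitutability and size monotonicity of the rule *)

Hypothesis hier : hierarchical rho.

Lemma Chier_mono q k A (B : {set I}) : A \subset B ->
  Chier r rho q k B :&: A \subset Chier r rho q k A /\
  #|Chier r rho q k A| <= #|Chier r rho q k B|.
Proof.
have [n] := ubnP #|B :\: A|; elim: n A => // n IHn A Bn AB.
have [BA|[b]] := set_0Vmem (B :\: A).
  have -> : B = A by apply/eqP; rewrite eqEsubset AB -setD_eq0 BA eqxx.
  by rewrite subsetIl.
move=> bBA; have [bA bB] : b \notin A /\ b \in B by apply/andP; rewrite -in_setD.
have [sub1 card1] := Chier_setU1 hier bA q k.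
have [||sub2 card2] := IHn (b |: A); last 1 first.
- split; last exact: leq_trans card1 card2.
  apply/subsetP => i /setIP[iB iA].
  have /(subsetP sub1) : i \in Chier r rho q k (b |: A).
    by apply: (subsetP sub2); rewrite !inE iB iA orbT.
  by rewrite in_setU1 => /predU1P[ib|//]; rewrite ib (negPf bA) in iA.
- by move: Bn; rewrite (cardsD1 b) bBA setDDl setUC; lia.
- by rewrite subUset sub1set bB.
Qed.
End Chier.

(** * Stable assignments for substitutable, size monotone offices *)

Section Assignments.
Context {I S : finType}.
Notation O := (S * vcat)%type.
Variable ch : O -> {set I} -> {set I}.
Hypothesis ch_sub : forall o A, ch o A \subset A.
Hypothesis ch_mono : forall o (A B : {set I}), A \subset B ->
  ch o B :&: A \subset ch o A /\ #|ch o A| <= #|ch o B|.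
Implicit Types (P : I -> pref S) (p : pref S) (mu nu : I -> option O).
Implicit Types (o : O) (A : {set contract I S}) (i : I).

(** Substitutability gives [ch o B \subset ch o A], and size monotonicity turns the inclusion into
    equality. *)
Lemma ch_irrelevance o (A B : {set I}) : ch o B \subset A -> A \subset B -> ch o A = ch o B.
Proof.
move=> cBA AB; have [sub card] := ch_mono o AB; apply/esym/eqP.
by rewrite eqEcard card -{1}(setIidPl cBA) sub.
Qed.

Lemma ch_substitutes o (A B : {set I}) i : A \subset B -> i \in A -> i \in ch o B -> i \in ch o A.
Proof. by move=> /(ch_mono o)[/subsetP sub _] iA iB; apply: sub; rewrite inE iB. Qed.

Lemma prefers_mem p (x y : option O) : prefers p x y -> x \in p.
Proof. by move=> xy; rewrite -index_mem (leq_trans xy) ?index_size. Qed.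

Lemma prefers_total p (x y : option O) : x \in p -> x != y -> prefers p x y || prefers p y x.
Proof.
move=> xp; rewrite /prefers -neq_ltn; apply: contra => /eqP ixy.
by rewrite -(nth_index x xp) ixy nth_index // -index_mem -ixy index_mem.
Qed.

Definition demand P mu o : {set I} :=
  [set i | prefers (P i) (Some o) None && wprefers (P i) (Some o) (mu i)].

(** A fixed-point form of stability: choosing from everybody who would take [o], the office ends up
    with its own assignees. This covers both individual rationality and the absence of blocking. *)
Definition stable_assignment P mu :=
  forall o, ch o (demand P mu o) = [set i | mu i == Some o].

Lemma stable_demand P mu i o : stable_assignment P mu -> mu i = Some o -> i \in demand P mu o.
Proof. by move=> st mui; apply: (subsetP (ch_sub o _)); rewrite (st o) inE mui. Qed.

Lemma stable_rational P mu i : stable_assignment P mu -> wprefers (P i) (mu i) None.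
Proof.
move=> st; case E: (mu i) => [o|]; last exact: leqnn.
by have := stable_demand st E; rewrite inE => /andP[/ltnW].
Qed.

Lemma envy_demand P mu i o : stable_assignment P mu ->
  prefers (P i) (Some o) (mu i) -> i \in demand P mu o.
Proof.
move=> st omu; rewrite inE; apply/andP; split; last exact: ltnW.
exact: leq_trans omu (stable_rational i st).
Qed.

Lemma card_assigned mu : #|[set i | mu i]| = \sum_o #|[set i | mu i == Some o]|.
Proof.
rewrite cardsE -sum1_card big_mkcond /=.
under [RHS]eq_bigr do rewrite cardsE -sum1_card big_mkcond /=.
rewrite exchange_big; apply: eq_bigr => i _.
rewrite -big_mkcond sum1_card unfold_in /=; case: (mu i) => [o|] /=; last by rewrite eq_card0.
by rewrite -(card1 o); apply: eq_card => o'; rewrite [RHS]eq_sym.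
Qed.

(** Whoever [nu] assigns is assigned by [mu]. Conversely, each office faces a smaller demand under
    [mu], so it fills no more places than under [nu]; summed over offices, the assigned sets
    coincide. *)
Lemma rural_hospitals P mu nu : stable_assignment P mu -> stable_assignment P nu ->
  (forall i, wprefers (P i) (mu i) (nu i)) -> forall i, mu i -> nu i.
Proof.
move=> smu snu munu; pose M := [set i | mu i]; pose N := [set i | nu i].
suff /setP NM : N = M by move=> i; have := NM i; rewrite !inE => ->.
apply/eqP; rewrite eqEcard; apply/andP; split.
  apply/subsetP => i; rewrite !inE; case nui: (nu i) => [o|//] _.
  have := stable_demand snu nui; rewrite inE => /andP[oN _].
  have := munu i; rewrite nui; case: (mu i) => // /leq_ltn_trans/(_ oN).
  by rewrite ltnn.
rewrite /M /N !card_assigned; apply: leq_sum => o _; rewrite -smu -snu.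
suff /(ch_mono o)[] : demand P mu o \subset demand P nu o by [].
apply/subsetP => i; rewrite !inE => /andP[-> omu]; apply: leq_trans omu (munu i).
Qed.

(** * Strategy-proofness from optimality *)

Lemma index_take (T : eqType) (x : T) n s : index x (take n s) = minn (index x s) n.
Proof.
elim: s n => [|y s IHs] [|n] //=; rewrite ?minn0 //.
by case: eqP => // _; rewrite IHs minnSS.
Qed.

(* Suppose [i] obtains [o] by misreporting, where [o] is better than her
   truthful assignment. If her list is cut off below [o], the optimal stable
   assignment leaves her out. Both this assignment and the manipulated one
   remain stable when [o] is the only item on her list, which contradicts
   [rural_hospitals]. *)
Lemma optimal_stable_strategy_proof (phi : (I -> pref S) -> I -> option O) :
  (forall P, stable_assignment P (phi P)) ->
  (forall P nu, stable_assignment P nu -> forall i, wprefers (P i) (phi P i) (nu i)) ->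
  forall P i p', ~ prefers (P i) (phi (upd P i p') i) (phi P i).
Proof.
move=> phi_st phi_opt P i p'; set nu := phi (upd P i p') => nu_mu.
have muN : wprefers (P i) (phi P i) None by apply: stable_rational.
case nui: (nu i) nu_mu => [o|]; last first.
  by move=> /leq_trans/(_ muN); rewrite ltnn.
move=> nu_mu; set k := index (Some o) (P i).
have oN : k < index None (P i) by apply: leq_trans nu_mu muN.
(* [k.+1] keeps [o] as the last item. [None] is absent from both new lists; its index is then their
   length, so it ranks right below [o]. *)
pose P1 := upd P i (take k.+1 (P i)); pose P2 := upd P i [:: Some o].
have updE p : upd P i p i = p by rewrite /upd eqxx.
have updN p j : j != i -> upd P i p j = P j by rewrite /upd => /negPf->.
set la := phi P1; have la_st : stable_assignment P1 la by apply: phi_st.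
have iP1 mu o' : (i \in demand P1 mu o') =
    (index (Some o') (P i) <= k) &&
    (minn (index (Some o') (P i)) k.+1 <= minn (index (mu i) (P i)) k.+1).
  rewrite inE /prefers /wprefers /P1 updE !index_take; congr (_ && _).
  move: (index _ _) (index _ _) oN => a c; lia.
have lai : la i = None.
  case lai: (la i) => [o'|//].
  have := stable_demand la_st lai; rewrite iP1 => /andP[o'k _].
  (* Were [i] assigned under [la], the cut would alter no demand, so [la] would be stable for [P]
     and give [i] more than the optimal [phi P] does. *)
  suff /phi_opt/(_ i) : stable_assignment P la.
    by rewrite lai /wprefers; move: nu_mu o'k; rewrite /prefers -/k; lia.
  move=> o''; rewrite -la_st; congr (ch _ _); apply/setP => j.
  have [->|ji] := eqVneq j i; last by rewrite !inE /P1 updN.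
  rewrite iP1 inE lai /prefers /wprefers.
  move: (index (Some o') _) (index (Some o'') _) (index None _) o'k oN => a c d; lia.
have iP2 mu o' : i \in demand P2 mu o' -> o' = o.
  rewrite inE /P2 updE => /andP[/prefers_mem]; rewrite inE => /eqP[->] _ //.
(* Passing from [P1] to [P2] only withdraws demands of [i], whom no office chooses under [la]. For
   [nu] below, she withdraws all demands but the one for the office she holds. *)
have la2 : stable_assignment P2 la.
  move=> o'; rewrite -la_st; apply: ch_irrelevance.
    rewrite la_st; apply/subsetP => j; rewrite inE => /eqP laj.
    have ji : j != i by apply: contra_eqN laj => /eqP->; rewrite lai.
    by have := stable_demand la_st laj; rewrite !inE /P1 /P2 !updN.
  apply/subsetP => j; have [->|ji] := eqVneq j i; last by rewrite !inE /P1 /P2 !updN.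
  by move=> /iP2->; rewrite iP1 lai -/k; move: (index None _) oN => a; lia.
have nu2 : stable_assignment P2 nu.
  have nu_st : stable_assignment (upd P i p') nu by apply: phi_st.
  move=> o'; rewrite -nu_st; apply: ch_irrelevance.
    rewrite nu_st; apply/subsetP => j; rewrite inE => /eqP nuj.
    have [ji|ji] := eqVneq j i; last first.
      by have := stable_demand nu_st nuj; rewrite !inE /P2 !updN.
    by move: nuj; rewrite ji nui => -[<-]; rewrite inE nui /P2 updE /prefers /wprefers /= eqxx.
  apply/subsetP => j; have [->|ji] := eqVneq j i; last by rewrite !inE /P2 !updN.
  by move=> /iP2->; apply: (stable_demand nu_st).
have nu_in : phi P2 i.
  move: (phi_opt P2 _ nu2 i); rewrite nui /P2 updE; case: (phi P2 i) => //.
  by rewrite /wprefers /= eqxx.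
by have := rural_hospitals (phi_st P2) la2 (phi_opt P2 _ la2) nu_in; rewrite lai.
Qed.

(** * The cumulative offer process with offices *)

Definition applicants A o : {set I} := [set i | (i, o.1, o.2) \in A].

(** Individuals work down their lists and move on only when rejected. By the last clause, nobody has
    proposed below what a stable assignment gives her. *)
Record proposals_inv P A : Prop := ProposalsInv {
  proposed_acceptable : forall i o, i \in applicants A o -> prefers (P i) (Some o) None;
  proposed_downward : forall i o o', i \in applicants A o' ->
    prefers (P i) (Some o) (Some o') -> i \in applicants A o;
  proposed_rejected : forall i o o', i \in applicants A o' ->
    prefers (P i) (Some o) (Some o') -> i \notin ch o (applicants A o);
  proposed_optimal : forall nu, stable_assignment P nu -> forall i o,
    i \in applicants A o -> wprefers (P i) (Some o) (nu i) }.

Lemma first_acceptableP p (a : pred O) :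
  match ohead [seq o <- pmap id (take (index None p) p) | a o] with
  | Some o => [/\ prefers p (Some o) None, a o &
                 forall o', prefers p (Some o') (Some o) -> ~~ a o']
  | None => forall o, prefers p (Some o) None -> ~~ a o
  end.
Proof.
elim: p => [//|[x|] p] //=; rewrite /prefers /=.
case: ifP => [ax _|/negbT nax]; first by rewrite /= eqxx; split=> // o'; rewrite ltn0.
case: ohead => [o [oN ao IH]|IH o]; last by case: eqP => [[<-]//|_ /IH].
have xo : x != o by apply: contraNneq nax => ->.
have xo' : (Some x == Some o) = false by apply/eqP => -[/eqP]; rewrite (negPf xo).
rewrite !xo'; split=> // o'; case: eqP => [[<-]//|_]; exact: IH.
Qed.

Lemma next_propP P A i : match next_prop P A i with
  | Some o => [/\ prefers (P i) (Some o) None, i \notin applicants A o &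
                forall o', prefers (P i) (Some o') (Some o) -> i \in applicants A o']
  | None => forall o, prefers (P i) (Some o) None -> i \in applicants A o
  end.
Proof.
rewrite /next_prop.
have := first_acceptableP (P i) (fun sv => (i, sv.1, sv.2) \notin A).
case: ohead => [o [oN oA oP]|oP]; last by move=> o /oP; rewrite negbK inE.
by split=> [||o' /oP]; rewrite ?inE // negbK.
Qed.

Lemma proposals_inv0 P : proposals_inv P set0.
Proof. by split=> [i o|i o o'|i o o'|nu _ i o]; rewrite !inE. Qed.

(** Of two offices she applied to, the better one must have rejected her before she turned to the
    other. *)
Lemma holds_one P A i o o' : proposals_inv P A ->
  i \in ch o (applicants A o) -> i \in ch o' (applicants A o') -> o = o'.
Proof.
move=> inv io io'; apply/eqP/negPn/negP => noo'.
have app := subsetP (ch_sub _ _).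
have /prefers_mem oP := proposed_acceptable inv (app _ _ _ io).
have /orP[oo'|oo'] := @prefers_total (P i) (Some o) (Some o') oP noo'.
  by move: io; rewrite (negPf (proposed_rejected inv (app _ _ _ io') oo')).
by move: io'; rewrite (negPf (proposed_rejected inv (app _ _ _ io) oo')).
Qed.

Lemma applicants_setU1 A i o o' :
  applicants ((i, o.1, o.2) |: A) o' =
  if o' == o then i |: applicants A o' else applicants A o'.
Proof.
apply/setP => j; case: ifP => [/eqP->|oo']; rewrite !inE !xpair_eqE ?eqxx ?andbT //.
by rewrite -andbA -xpair_eqE -!surjective_pairing oo' andbF.
Qed.

(** Rejections are final: by substitutability, a new applicant never brings back a rejected one. *)
Lemma proposals_inv_next P A i o : proposals_inv P A ->
  (forall o', i \notin ch o' (applicants A o')) -> next_prop P A i = Some o ->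
  proposals_inv P ((i, o.1, o.2) |: A).
Proof.
move=> inv unheld nextE; have := next_propP P A i; rewrite nextE => -[oN oA oP].
have subA o' : applicants A o' \subset applicants ((i, o.1, o.2) |: A) o'.
  by apply/subsetP => j; rewrite !inE => ->; rewrite orbT.
have newP j o' : j \in applicants ((i, o.1, o.2) |: A) o' ->
    j = i /\ o' = o \/ j \in applicants A o'.
  rewrite applicants_setU1; case: eqP => [->|]; last by right.
  by rewrite in_setU1 => /predU1P[|]; auto.
have rejected j o1 : j \in applicants A o1 -> j \notin ch o1 (applicants A o1) ->
    j \notin ch o1 (applicants ((i, o.1, o.2) |: A) o1).
  by move=> jA; apply: contra; apply: ch_substitutes.
split.
- by move=> j o' /newP[[-> ->]//|]; apply: (proposed_acceptable inv).
- move=> j o1 o2 /newP[[-> ->] /oP|jA /(proposed_downward inv jA)]; exact: (subsetP (subA _)).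
- move=> j o1 o2 /newP[[-> ->] /oP i1|jA o12]; first exact: rejected (unheld _).
  by apply: rejected (proposed_rejected inv jA o12); apply: proposed_downward o12.
move=> nu nu_st j o' /newP[[-> ->]|]; last exact: (proposed_optimal inv).
rewrite /wprefers leqNgt; apply/negP; case nui: (nu i) => [o1|].
  (* All applicants of [o1] belong to its demand under [nu], from which it chooses [i]; by
     substitutability it would hold [i] now. *)
  move=> /oP i1; have := unheld o1; rewrite (@ch_substitutes _ _ (demand P nu o1)) //.
    apply/subsetP => l lA; rewrite inE (proposed_acceptable inv lA).
    exact: (proposed_optimal inv nu_st lA).
  by rewrite nu_st inE nui.
by rewrite ltnNge ltnW.
Qed.

Lemma terminal_stable P A mu : proposals_inv P A ->
  (forall i o, (mu i == Some o) = (i \in ch o (applicants A o))) ->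
  (forall i, mu i = None -> next_prop P A i = None) ->
  stable_assignment P mu /\
  (forall nu, stable_assignment P nu -> forall i, wprefers (P i) (mu i) (nu i)).
Proof.
move=> inv muE stop.
have mu_app i o : mu i = Some o -> i \in applicants A o.
  by move=> /eqP; rewrite muE; apply: (subsetP (ch_sub _ _)).
have all_app i o : mu i = None -> prefers (P i) (Some o) None -> i \in applicants A o.
  by move=> /stop nextE; have := next_propP P A i; rewrite nextE; apply.
split=> [o|nu nu_st i].
  transitivity (ch o (applicants A o)); last by apply/setP => i; rewrite [RHS]inE muE.
  (* At the end the applicants of [o] are exactly its demand: the assigned have tried every better
     office, the unassigned every acceptable one. *)
  congr (ch _ _); apply/setP => i; rewrite inE; apply/andP/idP => [[oN omu]|iA].
    case mui: (mu i) omu => [o'|] omu; last exact: all_app.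
    move: omu; rewrite /wprefers leq_eqVlt.
    case/predU1P=> [|/(proposed_downward inv (mu_app _ _ mui))//].
    move=> /(congr1 (nth None (P i))); rewrite !nth_index ?(prefers_mem oN) //.
      by move=> [->]; apply: mu_app.
    exact/prefers_mem/(proposed_acceptable inv (mu_app _ _ mui)).
  split; first exact: proposed_acceptable iA.
  case mui: (mu i) => [o'|]; last exact/ltnW/(proposed_acceptable inv iA).
  rewrite /wprefers leqNgt; apply/negP => /(proposed_rejected inv iA).
  by rewrite -muE mui eqxx.
case mui: (mu i) => [o|]; first exact: (proposed_optimal inv nu_st (mu_app _ _ mui)).
case nui: (nu i) => [o|]; last exact: leqnn.
have := stable_demand nu_st nui; rewrite inE => /andP[/(all_app _ _ mui) iA _].
suff : mu i == Some o by rewrite mui.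
rewrite muE; apply: (@ch_substitutes _ _ (demand P nu o)) => //; last first.
  by rewrite nu_st inE nui.
apply/subsetP => l lA; rewrite inE (proposed_acceptable inv lA).
exact: (proposed_optimal inv nu_st lA).
Qed.
End Assignments.

(** * From offices back to the institutions of the market *)

Section Market.
Context {I S : finType} {L : nat} (m : market I S L).
Hypothesis rank_inj : forall s, injective (rank m s).
Hypothesis hier : hierarchical (rho m).
Notation O := (S * vcat)%type.
Implicit Types (P : I -> pref S) (o : O) (i : I) (s : S) (v : vcat).
Implicit Types (A Y W : {set contract I S}) (x : contract I S).

Definition choice o (B : {set I}) : {set I} :=
  Chier (rank m o.1) (rho m) (cap m o.1 o.2) (kappa m o.1 o.2) B.

Lemma choice_sub o B : choice o B \subset B.
Proof. exact: Chier_sub. Qed.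

Lemma choice_mono o (B B' : {set I}) : B \subset B' ->
  choice o B' :&: B \subset choice o B /\ #|choice o B| <= #|choice o B'|.
Proof. by apply: Chier_mono. Qed.

(* What the offices [(s, v)] select from [Y] when they ignore each other; this
   is the completion of the aggregate choice rules. *)
Definition chosen Y : {set contract I S} :=
  [set x | ci x \in choice (cs x, ct x) (applicants Y (cs x, ct x))].

(** Those whom earlier categories remove from the pool of [v] would not be chosen by [v], so by
    irrelevance its choice is unchanged. *)
Lemma Cagg_chosen s Y :
  (forall i v v', i \in choice (s, v) (applicants Y (s, v)) ->
     i \in choice (s, v') (applicants Y (s, v')) -> v = v') ->
  Cagg m s Y = Ys (chosen Y) s.
Proof.
pose N v := choice (s, v) (applicants Y (s, v)) => N1.
pose Cd (vs : seq vcat) : {set I} := [set i | has (fun v => i \in N v) vs].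
pose out (vs : seq vcat) : {set contract I S} :=
  [set x | [&& cs x == s, ct x \in vs & ci x \in N (ct x)]].
have stepE vs ws : uniq (vs ++ ws) ->
    foldl (agg_step m s Y) (Cd vs, out vs) ws = (Cd (vs ++ ws), out (vs ++ ws)).
  elim: ws vs => [|v ws IHws] vs uvw /=; first by rewrite cats0.
  have -> : Chier (rank m s) (rho m) (cap m s v) (kappa m s v)
      [set i | ((i, s, v) \in Y) && (i \notin Cd vs)] = N v.
    apply: (@ch_irrelevance _ _ choice choice_mono (s, v)).
      apply/subsetP => i iN; rewrite inE.
      have := subsetP (choice_sub _ _) _ iN; rewrite inE /= => -> /=.
      rewrite inE; apply/hasPn => v' v'vs; apply: contraL v'vs => iN'.
      rewrite -(N1 _ _ _ iN iN').
      by move: uvw; rewrite cat_uniq /= negb_or => /and3P[_ /andP[]].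
    by apply/subsetP => i; rewrite !inE => /andP[].
  rewrite -cat_rcons -IHws ?cat_rcons //; congr (foldl _ (_, _) _).
    by apply/setP => i; rewrite !inE has_rcons orbC.
  apply/setP => x; rewrite !inE mem_rcons inE.
  case: (eqVneq (ct x) v) => [<-|_]; last by rewrite !andbF orbF.
  by case: (cs x == s); case: (ct x \in vs); case: (ci x \in N (ct x)).
rewrite /Cagg; have -> : (set0, set0) = (Cd [::], out [::]).
  by congr (_, _); apply/setP => x; rewrite !inE // andbF.
rewrite stepE /=; last by rewrite !inE; do !case: eqP => //.
apply/setP => x.
have vx : ct x \in vorder by case: (ct x) => [|[]]; rewrite !inE eqxx ?orbT.
rewrite [LHS]inE vx !inE /= andbC.
by case: (cs x =P s) => [->|_]; rewrite ?andbT ?andbF.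
Qed.

(** Every step adds a new contract to [A], so the bound makes the run end because nobody can
    propose, not for lack of fuel. *)
Lemma co_run_terminal P fuel A (Hd : S -> {set contract I S}) :
  proposals_inv choice P A -> (forall s, Hd s = Ys (chosen A) s) ->
  #|{: contract I S}| < #|A| + fuel ->
  exists A', [/\ proposals_inv choice P A', co_run m P fuel A Hd = chosen A' &
    forall i, (forall o, i \notin choice o (applicants A' o)) -> next_prop P A' i = None].
Proof.
elim: fuel A Hd => [|fuel IH] A Hd inv HdE; first by rewrite addn0 ltnNge max_card.
move=> cA.
have stop : \bigcup_s Hd s = chosen A.
  apply/setP => x; apply/bigcupP/idP => [[s _]|xA].
    by rewrite HdE inE => /andP[].
  by exists (cs x) => //; rewrite HdE inE xA eqxx.
have heldP i : ~~ held Hd i <-> forall o, i \notin choice o (applicants A o).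
  split=> [nh [s v]|unheld].
    apply: contra nh => iA; apply/existsP; exists s; apply/existsP.
    by exists (i, s, v); rewrite HdE !inE /= iA !eqxx.
  apply/existsPn => s; apply/existsPn => x; rewrite HdE !inE.
  by apply/negP => /andP[/andP[xA _] /eqP xi]; move: xA; rewrite xi (negPf (unheld _)).
rewrite /=; case: pickP => [i /andP[/heldP unheld]|none]; last first.
  exists A; split=> // i /heldP nh; have := none i; rewrite nh /=.
  by case: next_prop.
case nextE: (next_prop P A i) => [[s v]|//] _.
have inv' := proposals_inv_next choice_mono inv unheld nextE.
apply: IH => //= [s'|]; last first.
  have := next_propP P A i; rewrite nextE => -[_ iA _]; rewrite cardsU1.
  by move: iA; rewrite inE => ->; rewrite add1n addSnnS.
case: eqP => [->|s's].
  apply: Cagg_chosen => i' v1 v2 h1 h2.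
  by have [] := holds_one choice_sub inv' h1 h2.
rewrite HdE; apply/setP => x; rewrite !inE; case: eqP => [xs'|]; rewrite ?andbF // !andbT.
have := applicants_setU1 A i (s, v) (cs x, ct x) => /= ->; case: eqP => // -[xs _].
by rewrite -xs' xs in s's.
Qed.

Lemma Phi_spec P :
  [/\ forall x, (x \in Phi m P) = (assign (Phi m P) (ci x) == Some (cs x, ct x)),
      stable_assignment choice P (assign (Phi m P)) &
      forall nu, stable_assignment choice P nu ->
        forall i, wprefers (P i) (assign (Phi m P) i) (nu i)].
Proof.
have [| | |A [inv PhiE stop]] := @co_run_terminal P #|{: contract I S}|.+1 set0 (fun=> set0).
- exact: proposals_inv0.
- move=> s; apply/setP => x; rewrite !inE; apply/esym/negP => /andP[xA _].
  by have := subsetP (choice_sub _ _) _ xA; rewrite !inE.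
- by rewrite cards0.
have memE i o : ((i, o.1, o.2) \in Phi m P) = (i \in choice o (applicants A o)).
  by rewrite /Phi PhiE inE /=; case: o.
have assignE i o : (assign (Phi m P) i == Some o) = (i \in choice o (applicants A o)).
  rewrite -memE /assign; case: pickP => [[[j s] v]|no] /=.
    rewrite inE => /andP[xPhi /eqP ji]; rewrite /ci /= in ji; subst j.
    apply/eqP/idP => [[<-]//|oPhi]; congr Some; apply: (holds_one choice_sub inv (i := i)).
      by rewrite -memE.
    by rewrite -memE.
  by apply/esym/negbTE; have := no (i, o.1, o.2); rewrite inE /ci /= eqxx andbT => ->.
have stop' i : assign (Phi m P) i = None -> next_prop P A i = None.
  by move=> iN; apply: stop => o; rewrite -assignE iN.
have [st opt] := terminal_stable choice_sub choice_mono inv assignE stop'.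
by split=> // x; rewrite assignE -memE; case: x => [[]].
Qed.

(** [W] lies between the outcome and the total demand, so irrelevance applies. Taking [W] to be the
    outcome gives consistency of the held sets; adding a set [Z] to it rules out blocking. *)
Lemma Cagg_demanded P s W : Phi m P \subset W ->
  {in W, forall x, ci x \in demand P (assign (Phi m P)) (cs x, ct x)} ->
  Cagg m s W = Ys (Phi m P) s.
Proof.
move=> PhiW Wdem; have [memE st _] := Phi_spec P.
have cE o : choice o (applicants W o) = [set i | assign (Phi m P) i == Some o].
  rewrite -st; apply: (ch_irrelevance choice_mono).
    rewrite st; apply/subsetP => i; rewrite !inE => iPhi.
    by apply: (subsetP PhiW); rewrite memE /ci /cs /ct /= -surjective_pairing.
  by apply/subsetP => i; rewrite inE => /Wdem; rewrite /ci /cs /ct /= -surjective_pairing.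
rewrite Cagg_chosen => [|i v v']; last by rewrite !cE !inE => /eqP-> /eqP[].
by congr (Ys _ s); apply/setP => x; rewrite inE cE inE memE.
Qed.

Lemma Phi_stable P : wf_profile m P -> stable m P (Cagg m) (Phi m P).
Proof.
move=> wfP; have [memE st _] := Phi_spec P.
have demE x : x \in Phi m P -> ci x \in demand P (assign (Phi m P)) (cs x, ct x).
  by rewrite memE => /eqP; apply: (stable_demand choice_sub).
split.
  split=> [x xPhi|i].
    have /andP[_ /forallP/(_ (Some (cs x, ct x)))/eqP] := wfP (ci x).
    have := demE x xPhi; rewrite inE => /andP[/prefers_mem -> _] /esym.
    by rewrite /= /valid_contract.
  apply/card_le1_eqP => x y; rewrite !inE !memE => /andP[xE /eqP xi] /andP[yE /eqP yi].
  move: xE yE; rewrite xi yi => /eqP-> /eqP[].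
  by case: x y xi yi => [[? ?] ?] [[? ?] ?]; rewrite /ci /cs /ct /= => -> -> -> ->.
split=> [i|]; first exact: (stable_rational choice_sub).
split=> [s|[Z [/set0Pn[z zZ] Zval Zsub Zpref]]].
  exact: Cagg_demanded.
have Zdem z' : z' \in Z -> ci z' \in demand P (assign (Phi m P)) (cs z', ct z').
  move=> z'Z; have [|z1 [Zi z1pref]] := Zpref (ci z'); first exact: imset_f.
  have : z' \in Yi Z (ci z') by rewrite inE z'Z eqxx.
  rewrite Zi inE => /eqP z1E; rewrite -z1E in z1pref.
  exact: (envy_demand choice_sub).
have := Zsub (cs z) (imset_f _ zZ); rewrite (@Cagg_demanded P).
- have /andP[_ zPhi] := Zval _ zZ.
  by move=> /subsetP/(_ z); rewrite !inE zZ eqxx (negPf zPhi) => /(_ isT).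
- exact: subsetUl.
- by move=> x; rewrite inE => /orP[/demE|/Zdem].
Qed.

(** An envious [j] is in the demand from which the office chose [ci x]; with a better rank and all
    types of [ci x], she would have been chosen too. *)
Lemma Phi_no_envy P : eliminates_justified_envy m P (Phi m P).
Proof.
have [memE st _] := Phi_spec P.
move=> j x xPhi xj jx; set o := (cs x, ct x) in jx.
have jdem : j \in demand P (assign (Phi m P)) o.
  exact: (envy_demand choice_sub).
have xch : ci x \in choice o (demand P (assign (Phi m P)) o).
  by rewrite st inE -memE.
have [sub|] := boolP (rho m (ci x) \subset rho m j); [left|by right].
rewrite /better ltn_neqAle (inj_eq (rank_inj (s := _))) xj leqNgt.
apply/negP => jltx; have := Chier_no_envy (rank_inj (s := _)) xch jdem sub jltx.
rewrite -/(choice o _) st inE => /eqP jo.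
by move: jx; rewrite jo /prefers ltnn.
Qed.

Lemma Phi_strategy_proof : strategy_proof m.
Proof.
move=> P _ i p' _; pose phi P := assign (Phi m P).
apply: (@optimal_stable_strategy_proof _ _ _ choice_sub choice_mono phi) => {}P.
  by have [] := Phi_spec P.
by have [] := Phi_spec P.
Qed.
End Market.

Theorem theorem3 (I S : finType) (L : nat) (m : market I S L) :
  (forall s : S, injective (rank m s)) ->
  hierarchical (rho m) ->
  (forall P : I -> pref S, wf_profile m P -> stable m P (Cagg m) (Phi m P)) /\
  strategy_proof m /\
  (forall P : I -> pref S, wf_profile m P -> eliminates_justified_envy m P (Phi m P)).
Proof.
move=> rank_inj hier; split; first by move=> P; apply: Phi_stable.
split; first exact: Phi_strategy_proof.
by move=> P _; apply: Phi_no_envy.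
Qed.
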